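(* Let $A$ be an annihilator nilpotent skew brace. Then: (1) $T_+(A)=T_\circ(A)$; (2) $T_+(A)$ is an ideal of $A$; (3) $T_+(A/T_+(A))=\{0\}$; (4) $T_+(A)$ is finite if $A$ is finitely generated as a skew brace.
   Context: A skew brace is a triple $(A,+,\circ)$ where $(A,+)$ and $(A,\circ)$ are (not necessarily abelian) groups such that $a\circ(b+c)=a\circ b-a+a\circ c$ for all $a,b,c\in A$. The two groups share the same identity, denoted $0$. Put $\lambda_a(b)=-a+a\circ b$. A sub skew brace is a subset that is a subgroup of both $(A,+)$ and $(A,\circ)$; $A$ is finitely generated as a skew brace if some finite subset is contained in no proper sub skew brace. An ideal of $A$ is a subset that is a normal subgroup of both $(A,+)$ and $(A,\circ)$ and is mapped into itself by every $\lambda_a$. The annihilator is $\operatorname{Ann}(A)=\{x\in A: x\circ a=a\circ x=x+a=a+x \text{ for all } a\in A\}$, an ideal of $A$. An annihilator series of $A$ is a series of ideals $0=I_0\subseteq I_1\subseteq\cdots\subseteq I_n=A$ with $I_{j+1}/I_j\subseteq\operatorname{Ann}(A/I_j)$ for $0\le j<n$; $A$ is annihilator nilpotent if it has an annihilator series. $T_+(A)$ denotes the set of elements of finite order in $(A,+)$, and $T_\circ(A)$ the set of elements of finite order in $(A,\circ)$. *)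

(* Defs.v *)
From HB Require Import structures.
From mathcomp Require Import all_boot.
From mathcomp Require Import boolp classical_sets cardinality.

Set Implicit Arguments.
Unset Strict Implicit.
Unset Printing Implicit Defensive.

Declare Scope skew_brace_scope.
Delimit Scope skew_brace_scope with sb.

Local Open Scope classical_set_scope.
Local Open Scope quotient_scope.
Local Open Scope group_scope.
Local Open Scope skew_brace_scope.

(* The circle group (A, o) is the MathComp group structure of A, written      *)
(* 1, *, ^-1. The additive group has its own operations, because MathComp's   *)
(* additive groups (zmodType) are commutative. The equality of the two        *)
(* identities is a consequence of the axioms, see sb_one0 below.              *)
HB.mixin Record isSkewBrace A of Group A := {
  sbzero : A;
  sbopp : A -> A;
  sbadd : A -> A -> A;
  sbaddA : associative sbadd;
  sbadd0r : left_id sbzero sbadd;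
  sbaddr0 : right_id sbzero sbadd;
  sbaddNr : left_inverse sbzero sbopp sbadd;
  sbaddrN : right_inverse sbzero sbopp sbadd;
  sbmulDr : forall a b c : A,
    a * sbadd b c = sbadd (sbadd (a * b) (sbopp a)) (a * c)
}.

#[short(type="skewBraceType")]
HB.structure Definition SkewBrace := {A of isSkewBrace A & Group A}.

Notation "0" := (@sbzero _) : skew_brace_scope.
Notation "- x" := (sbopp x) : skew_brace_scope.
Notation "x + y" := (sbadd x y) : skew_brace_scope.
Notation "x - y" := (sbadd x (sbopp y)) : skew_brace_scope.

(* A copy of A on which the multiplicative group notation means (A, +). *)
Definition addgroup (A : Type) : Type := A.

HB.instance Definition _ (A : skewBraceType) :=
  Choice.copy (addgroup A) A.
HB.instance Definition _ (A : skewBraceType) :=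
  isGroup.Build (addgroup A) (@sbaddA A) (@sbadd0r A) (@sbaddr0 A)
    (@sbaddNr A) (@sbaddrN A).

Section GroupSets.
Variable G : groupType.

Definition is_subgroup (H : set G) : Prop :=
  [/\ H 1, forall x y, H x -> H y -> H (x * y) & forall x, H x -> H x^-1].

Definition is_normal_subgroup (H : set G) : Prop :=
  is_subgroup H /\ forall x y, H x -> H (x ^ y).

Definition torsion : set G := [set x | exists n : nat, (0 < n)%N /\ x ^+ n = 1].

Lemma is_normal_mul (H : set G) x x' y y' : is_normal_subgroup H ->
  H (x^-1 * x') -> H (y^-1 * y') -> H ((x * y)^-1 * (x' * y')).
Proof.
move=> [[_ HM _] HJ] Hx Hy.
have -> : (x * y)^-1 * (x' * y') = (y^-1 * y') * ((x^-1 * x') ^ y').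
  by rewrite conjgE invgM !mulgA mulgK.
by apply: HM => //; apply: HJ.
Qed.

Lemma is_normal_inv (H : set G) x x' : is_normal_subgroup H ->
  H (x^-1 * x') -> H ((x^-1)^-1 * x'^-1).
Proof.
move=> [[_ _ HV] HJ] /HV; rewrite invgM invgK => Hx.
have -> : x * x'^-1 = (x'^-1 * x) ^ x'^-1.
  by rewrite conjgE invgK !mulgA mulgV mul1g.
exact: HJ.
Qed.

End GroupSets.

Section SkewBraceSets.
Variable A : skewBraceType.

Definition lam (a b : A) : A := - a + a * b.

Definition Tadd : set A := @torsion (addgroup A).

Definition Tcirc : set A := @torsion A.

Definition is_sub_skew_brace (B : set A) : Prop :=
  @is_subgroup (addgroup A) B /\ @is_subgroup A B.

Definition finitely_generated : Prop :=
  exists S : set A, finite_set S /\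
    forall B : set A, is_sub_skew_brace B -> S `<=` B -> B = setT.

Definition is_ideal (I : set A) : Prop :=
  [/\ @is_normal_subgroup (addgroup A) I,
      @is_normal_subgroup A I
    & forall a b, I b -> I (lam a b)].

Definition Ann : set A :=
  [set x | forall a, [/\ x * a = a * x, a * x = x + a & x + a = a + x]].

Lemma sb_one0 : 1 = 0 :> A.
Proof.
have := sbmulDr (1 : A) 0 0; rewrite !mul1g !sbadd0r sbaddr0 => E.
by rewrite -[LHS]sbadd0r [in LHS]E sbaddNr.
Qed.

End SkewBraceSets.

Arguments Tadd A : clear implicits.
Arguments Tcirc A : clear implicits.
Arguments Ann A : clear implicits.

Record ideal (A : skewBraceType) := Ideal {
  ideal_set :> set A;
  idealP : is_ideal ideal_set
}.

Section Quotient.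
Variables (A : skewBraceType) (I : ideal A).

Definition eq_mod_ideal : rel A := fun x y => `[< ideal_set I (- x + y) >].

Lemma eq_mod_idealP x y : reflect (ideal_set I (- x + y)) (eq_mod_ideal x y).
Proof. exact: asboolP. Qed.

Lemma eq_mod_ideal_circ x y : ideal_set I (- x + y) <-> ideal_set I (x^-1 * y).
Proof.
have [_ _ Ilam] := idealP I; split=> [/(Ilam x^-1)|/(Ilam x)]; last first.
  by rewrite /lam mulVKg.
suff -> : lam x^-1 (- x + y) = x^-1 * y by [].
have -> : x^-1 * y = x^-1 * (x + (- x + y)) by rewrite sbaddA sbaddrN sbadd0r.
by rewrite sbmulDr mulVg sb_one0 sbadd0r.
Qed.

Lemma eq_mod_ideal_refl : reflexive eq_mod_ideal.
Proof.
by move=> x; apply/eq_mod_idealP; rewrite sbaddNr; have [[[]]] := idealP I.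
Qed.

Lemma eq_mod_ideal_sym : symmetric eq_mod_ideal.
Proof.
have [[[_ _ IN] _] _ _] := idealP I.
have aux x y : ideal_set I (- x + y) -> ideal_set I (- y + x).
  by move=> /IN; rewrite (invgM (- x : addgroup A)) invgK.
by move=> x y; apply/eq_mod_idealP/eq_mod_idealP => /aux.
Qed.

Lemma eq_mod_ideal_trans : transitive eq_mod_ideal.
Proof.
have [[[_ ID _] _] _ _] := idealP I.
move=> y x z /eq_mod_idealP Ixy /eq_mod_idealP Iyz; apply/eq_mod_idealP.
have := ID _ _ Ixy Iyz; congr (ideal_set I _).
by rewrite [LHS](mulgA (_ : addgroup A)) [X in mul X _]mulgK.
Qed.

Canonical eq_mod_ideal_equiv :=
  EquivRel eq_mod_ideal eq_mod_ideal_refl eq_mod_ideal_sym eq_mod_ideal_trans.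

Definition quot : Type := {eq_quot eq_mod_ideal}.

HB.instance Definition _ := Choice.on quot.
HB.instance Definition _ := EqQuotient.on quot.

Lemma pi_quotP (x y : A) : \pi_quot x = \pi_quot y <-> ideal_set I (- x + y).
Proof. by split=> [/eqmodP/eq_mod_idealP|/eq_mod_idealP/eqmodP]. Qed.

Lemma reprI (x : A) : ideal_set I (- repr (\pi_quot x) + x).
Proof. by apply/pi_quotP; rewrite reprK. Qed.

Lemma quot_ind (P : quot -> Prop) : (forall x, P (\pi_quot x)) -> forall X, P X.
Proof. by move=> Ppi X; rewrite -[X]reprK. Qed.

Definition quot_zero : quot := \pi_quot 0.
Definition quot_add (X Y : quot) : quot := \pi_quot (repr X + repr Y).
Definition quot_opp (X : quot) : quot := \pi_quot (- repr X).
Definition quot_one : quot := \pi_quot 1.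
Definition quot_mul (X Y : quot) : quot := \pi_quot (repr X * repr Y).
Definition quot_inv (X : quot) : quot := \pi_quot (repr X)^-1.

Lemma quot_addE x y : quot_add (\pi_quot x) (\pi_quot y) = \pi_quot (x + y).
Proof.
have [addI _ _] := idealP I.
by apply/pi_quotP; apply: (is_normal_mul addI); apply: reprI.
Qed.

Lemma quot_oppE x : quot_opp (\pi_quot x) = \pi_quot (- x).
Proof.
have [addI _ _] := idealP I.
by apply/pi_quotP; apply: (is_normal_inv addI); apply: reprI.
Qed.

Lemma quot_mulE x y : quot_mul (\pi_quot x) (\pi_quot y) = \pi_quot (x * y).
Proof.
have [_ mulI _] := idealP I.
apply/pi_quotP/eq_mod_ideal_circ; apply: (is_normal_mul mulI);
  exact/eq_mod_ideal_circ/reprI.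
Qed.

Lemma quot_invE x : quot_inv (\pi_quot x) = \pi_quot x^-1.
Proof.
have [_ mulI _] := idealP I.
apply/pi_quotP/eq_mod_ideal_circ; apply: (is_normal_inv mulI).
exact/eq_mod_ideal_circ/reprI.
Qed.

Let quotE := (quot_addE, quot_oppE, quot_mulE, quot_invE).

Lemma quot_mulA : associative quot_mul.
Proof.
move=> X Y Z; elim/quot_ind: X => x; elim/quot_ind: Y => y; elim/quot_ind: Z => z.
by rewrite !quotE mulgA.
Qed.

Lemma quot_mul1g : left_id quot_one quot_mul.
Proof. by move=> X; elim/quot_ind: X => x; rewrite !quotE mul1g. Qed.

Lemma quot_mulg1 : right_id quot_one quot_mul.
Proof. by move=> X; elim/quot_ind: X => x; rewrite !quotE mulg1. Qed.

Lemma quot_mulVg : left_inverse quot_one quot_inv quot_mul.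
Proof. by move=> X; elim/quot_ind: X => x; rewrite !quotE mulVg. Qed.

Lemma quot_mulgV : right_inverse quot_one quot_inv quot_mul.
Proof. by move=> X; elim/quot_ind: X => x; rewrite !quotE mulgV. Qed.

HB.instance Definition _ :=
  isGroup.Build quot quot_mulA quot_mul1g quot_mulg1 quot_mulVg quot_mulgV.

Lemma quot_addA : associative quot_add.
Proof.
move=> X Y Z; elim/quot_ind: X => x; elim/quot_ind: Y => y; elim/quot_ind: Z => z.
by rewrite !quotE sbaddA.
Qed.

Lemma quot_add0r : left_id quot_zero quot_add.
Proof. by move=> X; elim/quot_ind: X => x; rewrite !quotE sbadd0r. Qed.

Lemma quot_addr0 : right_id quot_zero quot_add.
Proof. by move=> X; elim/quot_ind: X => x; rewrite !quotE sbaddr0. Qed.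

Lemma quot_addNr : left_inverse quot_zero quot_opp quot_add.
Proof. by move=> X; elim/quot_ind: X => x; rewrite !quotE sbaddNr. Qed.

Lemma quot_addrN : right_inverse quot_zero quot_opp quot_add.
Proof. by move=> X; elim/quot_ind: X => x; rewrite !quotE sbaddrN. Qed.

Lemma quot_mulDr (a b c : quot) :
  a * quot_add b c = quot_add (quot_add (a * b) (quot_opp a)) (a * c).
Proof.
elim/quot_ind: a => x; elim/quot_ind: b => y; elim/quot_ind: c => z.
by rewrite /mul /= !quotE sbmulDr.
Qed.

HB.instance Definition _ := isSkewBrace.Build quot
  quot_addA quot_add0r quot_addr0 quot_addNr quot_addrN quot_mulDr.

Lemma pi_quotD x y : \pi_quot (x + y) = \pi_quot x + \pi_quot y.
Proof. by rewrite [RHS]quot_addE. Qed.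

Lemma pi_quotM x y : \pi_quot (x * y) = \pi_quot x * \pi_quot y.
Proof. by rewrite [RHS]quot_mulE. Qed.

End Quotient.

Definition annihilator_series (A : skewBraceType) (n : nat)
    (I : nat -> ideal A) : Prop :=
  [/\ I 0%N = [set 0] :> set A,
      I n = setT :> set A
    & forall j, (j < n)%N ->
        I j `<=` I j.+1 /\ \pi_(quot (I j)) @` I j.+1 `<=` Ann (quot (I j))].

Definition annihilator_nilpotent (A : skewBraceType) : Prop :=
  exists (n : nat) (I : nat -> ideal A), annihilator_series n I.

(* Main.v *)
(* An annihilator series is a central series of (A, +) with lam x c = c and     *)
(* lam c x = x modulo I_j for c in I_(j+1). Hence the torsion T of the          *)
(* nilpotent group (A, +) is a lam-invariant normal subgroup. If                *)
(* lam x x = x mod M, then x^m = m x mod M for every lam-invariant normal M:    *)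
(* with M = I_j, descending along the series, T_+ lies in T_o; conversely,      *)
(* when x^m = 1 the automorphism lam x has finite order and acts unipotently,   *)
(* so it is the identity mod T, and M = T gives x in T. Being equal to T_o, the *)
(* set T is also normal in (A, o).                                              *)
(* For finiteness, one shows by descending the series that A / I_j is finitely  *)
(* generated both as an additive and as a circle group: adjoining to additive   *)
(* generators F of A / I_(j+1) the finitely many I_(j+1)-components of          *)
(* lam f^(+-1) f' yields a lam-invariant additive subgroup, i.e. a sub skew     *)
(* brace, and then I_(j+1) / I_j is finitely generated because finitely         *)
(* generated nilpotent groups are polycyclic.                                   *)
Require Import Defs.
From HB Require Import structures.
From mathcomp Require Import all_boot.
From mathcomp Require Import boolp classical_sets cardinality.

Local Open Scope classical_set_scope.
Local Open Scope quotient_scope.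
Local Open Scope group_scope.
Local Open Scope skew_brace_scope.

Set Implicit Arguments.
Unset Strict Implicit.
Unset Printing Implicit Defensive.

(** Two facts about nilpotent groups carry the proof: torsion elements form a normal subgroup
    ([torsion_normal_subgroup]), and finitely generated subgroups are polycyclic ([gen_polycyclic]).
    Both apply to (A, +), where an annihilator series is central. So T = [Tadd A] is additively
    normal and [lam]-invariant, and [left_ideal_expg] compares circle powers with additive
    multiples: used modulo the I_j it gives [Tadd_sub_Tcirc], and modulo T it gives the converse,
    once [Tcirc_lam] shows that circle torsion acts trivially modulo T. For finiteness,
    [fg_mod_annihilator_series] carries finite generation down the series until (A, +) itself is
    finitely generated, hence polycyclic; then [torsion_polycyclic_finite] applies to T. *)

Notation gen := (smallest (@is_subgroup _)).

Lemma set_seq_cons (T : eqType) (x : T) (s : seq T) :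
  [set` x :: s] = x |` [set` s].
Proof.
apply/seteqP; split=> y /=; rewrite inE; first by move=> /predU1P.
by move=> ?; apply/predU1P.
Qed.

(** * Generated subgroups, normalisers and torsion *)

Section Groups.
Variable G : groupType.
Implicit Types (H K L M P S : set G) (x y z g h e : G) (F s t : seq G).

Lemma gen_subgroup S : is_subgroup (gen S).
Proof.
split=> [|x y Hx Hy|x Hx] H HS; have [[H1 HM HV] _] := HS => //.
- by apply: HM; [exact: Hx|exact: Hy].
- by apply: HV; exact: Hx.
Qed.

Lemma gen_sub H S : is_subgroup H -> S `<=` H -> gen S `<=` H.
Proof. by move=> HH SH; apply: smallest_sub. Qed.

Lemma gen_incl S T : S `<=` gen T -> gen S `<=` gen T.
Proof. by move=> ST; apply: gen_sub => //; exact: gen_subgroup. Qed.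

Lemma gen_id H : is_subgroup H -> gen H = H.
Proof. exact: smallest_id. Qed.

Lemma subgroupX H x m : is_subgroup H -> H x -> H (x ^+ m).
Proof.
by case=> H1 HM _ Hx; elim: m => [|m IH]; rewrite ?expg0// expgS; exact: HM.
Qed.

Lemma subgroupMr H x y : is_subgroup H -> H y -> H (x * y) -> H x.
Proof. by case=> _ HM HV Hy /HM/(_ (HV _ Hy)); rewrite mulgK. Qed.

(** Both conjugates are required: for infinite H, conjugation by g may map H properly into
    itself. *)
Definition normaliser H : set G :=
  [set g | forall h, H h -> H (h ^ g) /\ H (h ^ g^-1)].

Lemma normaliser_subgroup H : is_subgroup (normaliser H).
Proof.
split=> [h Hh|x y Nx Ny h Hh|x Nx h /Nx[]]; rewrite ?invg1 ?conjg1 ?invgK//.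
by rewrite invgM !conjgM; split; [apply: (Ny _ _).1; apply: (Nx _ _).1
  | apply: (Nx _ _).2; apply: (Ny _ _).2].
Qed.

Lemma subgroup_normaliser H : is_subgroup H -> H `<=` normaliser H.
Proof.
case=> _ HM HV x Hx h Hh; rewrite !conjgE invgK.
by have Hx' := HV _ Hx; split; exact: HM (HM _ _ _ _).
Qed.

(** By [xy,g] = [x,g]^y [y,g] and its analogue for inverses, commutator conditions modulo M can be
    checked on generators. *)
Lemma centraliser_mod_subgroup M P K : is_subgroup M -> is_subgroup K ->
  K `<=` normaliser M ->
  is_subgroup [set x | K x /\ forall g, P g -> M [~ x, g]].
Proof.
move=> [M1 MM MV] [K1 KM KV] nMK; split=> /= [|x y [Kx Mx] [Ky My]|x [Kx Mx]].
- by split=> // g _; rewrite comm1g.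
- split=> [|g Pg]; first exact: KM.
  have -> : [~ x * y, g] = [~ x, g] ^ y * [~ y, g].
    by rewrite /commg /conjg !invgM -!mulgA mulVKg mulVKg.
  apply: MM; last exact: My.
  exact: (nMK _ Ky _ (Mx _ Pg)).1.
- split=> [|g Pg]; first exact: KV.
  have -> : [~ x^-1, g] = ([~ x, g]^-1) ^ x^-1.
    by rewrite /commg /conjg !invgM !invgK -!mulgA mulgV mulg1.
  by apply: (nMK _ Kx _ (MV _ (Mx _ Pg))).2.
Qed.

Lemma torsion1 : torsion (1 : G).
Proof. by exists 1%N. Qed.

Lemma torsionV x : torsion x -> torsion x^-1.
Proof. by case=> m [m0 xm]; exists m; rewrite expVgn xm invg1. Qed.

Lemma torsionJ x y : torsion x -> torsion (x ^ y).
Proof. by case=> m [m0 xm]; exists m; rewrite -conjXg xm conj1g. Qed.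

Lemma torsionX x m : (0 < m)%N -> torsion (x ^+ m) -> torsion x.
Proof.
by move=> m0 [k [k0 xk]]; exists (m * k)%N; rewrite muln_gt0 m0 expgnA.
Qed.

(** * Polycyclic groups and their subgroups *)

Inductive polycyclic : set G -> Prop :=
| polycyclic1 : polycyclic [set 1]
| polycyclicS H e : polycyclic H -> normaliser H e ->
    polycyclic (gen (e |` H)).

Lemma polycyclic_subgroup H : polycyclic H -> is_subgroup H.
Proof.
case=> [|H' e _ _]; last exact: gen_subgroup.
by split=> //= [x y -> ->|x ->]; rewrite ?mulg1 ?invg1.
Qed.

(* Integer powers of e are encoded as e^-a e^b with a, b : nat. *)
Lemma gen_normalU1 H e x : is_subgroup H -> normaliser H e ->
  gen (e |` H) x -> exists h a b, H h /\ x = h * (e ^- a * e ^+ b).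
Proof.
move=> HH nHe.
have ePC a b c d : (e ^- a * e ^+ b) * (e ^- c * e ^+ d)
    = e ^- (a + c) * e ^+ (b + d).
  rewrite -!expVgn !expgnDr -!mulgA; congr (_ * _); rewrite !mulgA.
  congr (_ * _); apply: commuteX2.
  exact: commuteV (commute_refl _).
pose X : set G := [set x | exists h a b, H h /\ x = h * (e ^- a * e ^+ b)].
have nX a b : normaliser H (e ^- a * e ^+ b).
  have [_ nM nV] := normaliser_subgroup H.
  have nX m := subgroupX m (normaliser_subgroup H) nHe.
  by apply: nM => //; apply: nV.
have [H1 HM HV] := HH.
apply: (@gen_sub X) => [|y [->|Hy]]; last 2 first.
- by exists 1, 0%N, 1%N; rewrite expg0 invg1 !mul1g expg1.
- by exists y, 0%N, 0%N; rewrite expg0 invg1 !mulg1.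
split=> [|_ _ [h [a [b [Hh ->]]]] [k [c [d [Hk ->]]]]|_ [h [a [b [Hh ->]]]]].
- by exists 1, 0%N, 0%N; rewrite expg0 invg1 !mul1g.
- exists (h * k ^ (e ^- a * e ^+ b)^-1), (a + c)%N, (b + d)%N; split.
    by apply: HM => //; apply: (nX _ _ _ _).2.
  rewrite -ePC; move: (e ^- a * e ^+ b) (e ^- c * e ^+ d) => w v.
  by rewrite conjgE invgK -!mulgA mulKg.
- exists (h^-1 ^ (e ^- a * e ^+ b)), b, a; split.
    by apply: (nX _ _ _ _).1; apply: HV.
  have -> : e ^- b * e ^+ a = (e ^- a * e ^+ b)^-1 by rewrite invgM invgK.
  move: (e ^- a * e ^+ b) => w.
  by rewrite invgM conjgE !mulgA mulgK.
Qed.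

(* l0 = h0 e^m with m > 0 minimal, or 1 if L has no such element. *)
Lemma subgroup_normalU1 H L e : is_subgroup H -> normaliser H e ->
  is_subgroup L -> L `<=` gen (e |` H) ->
  exists2 l0, L l0 & forall l, L l ->
    exists x q, (L `&` H) x /\ (l = x * l0 ^+ q \/ l^-1 = x * l0 ^+ q).
Proof.
move=> HH nHe LL LHe.
have [H1 HM HV] := HH; have [L1 LM LV] := LL.
have nX m : normaliser H (e ^+ m).
  exact: subgroupX (normaliser_subgroup H) nHe.
have eC i j : e ^- i * e ^+ j = e ^+ j * e ^- i.
  rewrite -expVgn; apply/commute_sym/commuteX2.
  exact: commuteV (commute_refl _).
have pos l : L l -> exists h m, [/\ H h, L (h * e ^+ m)
    & l = h * e ^+ m \/ l^-1 = h * e ^+ m].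
  move=> Ll; have [h [a [b [Hh El]]]] := gen_normalU1 HH nHe (LHe _ Ll).
  have [ab|/ltnW ba] := leqP a b.
    suff E : l = h * e ^+ (b - a).
      by exists h, (b - a)%N; rewrite -E; split=> //; left.
    by rewrite El expgnFr// eC.
  have E : l^-1 = h^-1 ^ (e ^- (a - b)) * e ^+ (a - b).
    rewrite -conjgCV El [LHS]invgM; congr (_ * _).
    by rewrite expgnFr// invgM invgK eC.
  exists (h^-1 ^ (e ^- (a - b))), (a - b)%N; rewrite -E; split; last by right.
    by apply: (nX _ _ _).2; apply: HV.
  exact: LV.
pose P m := `[< (0 < m)%N /\ exists2 h, H h & L (h * e ^+ m) >].
have [exP|nP] := pselect (exists m, P m); last first.
  exists 1 => // l Ll; have [h [m [Hh Lhm El]]] := pos l Ll.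
  have m0 : m = 0%N.
    case: m Lhm {El} => // m Lhm; case: nP; exists m.+1.
    by apply/asboolP; split => //; exists h.
  move: Lhm El; rewrite m0 expg0 !mulg1 => Lh El.
  by exists h, 0%N; rewrite expg0 mulg1.
case: (ex_minnP exP) => m /asboolP[m0 [h0 Hh0 Ll0]] min.
exists (h0 * e ^+ m) => // l Ll; have [h [k [Hh Lhk El]]] := pos l Ll.
(* Division of k by m: up to a factor in H and a power of [l0], the element is e^(k mod m), and
   minimality of m forces the remainder to be 0. *)
suff [x Hx Ex] : exists2 x, H x & h * e ^+ k = x * (h0 * e ^+ m) ^+ (k %/ m).
  exists x, (k %/ m)%N; rewrite -Ex; split => //; split => //.
  by apply: (subgroupMr LL (subgroupX (k %/ m) LL Ll0)); rewrite -Ex.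
have [h1 Hh1 E1] : exists2 h1, H h1 &
    e ^+ (m * (k %/ m)) = h1 * (h0 * e ^+ m) ^+ (k %/ m).
  elim: (k %/ m) => [|q [h1 Hh1 E1]].
    by exists 1; rewrite ?muln0 ?mul1g.
  exists (h1 * (h0^-1) ^ (((h0 * e ^+ m) ^+ q)^-1)).
    apply: HM => //.
    have nh0 : normaliser H (h0 * e ^+ m).
      have [_ nM _] := normaliser_subgroup H.
      by apply: nM => //; apply: subgroup_normaliser.
    have := subgroupX q (normaliser_subgroup H) nh0.
    by move=> /(_ _ (HV _ Hh0))[].
  rewrite mulnS addnC expgnDr E1 -!mulgA; congr (_ * _).
  by rewrite expgSr invgK !mulKg.
have Ek : h * e ^+ k = h * h1 ^ (e ^- (k %% m)) * e ^+ (k %% m)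
    * (h0 * e ^+ m) ^+ (k %/ m).
  rewrite conjgE invgK -!mulgA mulKg -E1 -expgnDr addnC mulnC.
  by rewrite -divn_eq.
have Hhh : H (h * h1 ^ (e ^- (k %% m))).
  by apply: HM => //; apply: (nX _ _ _).2.
have : ~~ (0 < k %% m)%N.
  apply/negP => r0; have := ltn_pmod k m0; rewrite ltnNge => /negP; apply.
  apply: min; apply/asboolP; split=> //; exists (h * h1 ^ (e ^- (k %% m))) => //.
  by apply: (subgroupMr LL (subgroupX (k %/ m) LL Ll0)); rewrite -Ek.
rewrite -eqn0Ngt => /eqP r0.
by exists (h * h1 ^ (e ^- (k %% m))) => //; rewrite {1}Ek r0 expg0 mulg1.
Qed.

(** L is generated by [l0] and L ∩ H, and the induction provides finitely many generators of L ∩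
    H. *)
Lemma subgroup_polycyclic_fg H L : polycyclic H -> is_subgroup L -> L `<=` H ->
  exists s, L = gen [set` s].
Proof.
move=> pH; elim: pH L => [L LL L1|{}H e pH IH nHe L LL LHe].
  exists [::]; rewrite set_nil; apply/seteqP; split => [x /L1 ->|].
    by case: (gen_subgroup set0).
  exact: gen_sub.
have HH := polycyclic_subgroup pH.
have [l0 Ll0 HL] := subgroup_normalU1 HH nHe LL LHe.
have [L1 LM LV] := LL; have [H1 HM HV] := HH.
have [|x []//|s Es] := IH (L `&` H).
  by split=> [|x y [? ?] [? ?]|x [? ?]]; split;
    do ?[exact: LM|exact: HM|exact: LV|exact: HV].
exists (l0 :: s); apply/seteqP; split; last first.
  apply: gen_sub => // x /=; rewrite inE => /predU1P[->//|xs].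
  suff [] : (L `&` H) x by [].
  by rewrite Es; apply: sub_gen_smallest.
have [_ gM gV] := gen_subgroup [set` l0 :: s].
move=> l Ll; have [x [q [LHx El]]] := HL l Ll.
have gl : gen [set` l0 :: s] (x * l0 ^+ q).
  apply: gM; last first.
    apply: (subgroupX q (gen_subgroup _)).
    by apply: sub_gen_smallest; rewrite /= mem_head.
  move: LHx; rewrite Es; apply: gen_incl => y /= ys.
  by apply: sub_gen_smallest; rewrite /= inE ys orbT.
case: El => El; first by rewrite El.
by rewrite -[l]invgK El; apply: gV.
Qed.

(** Up to inversion, every element of L is a product of an element of L ∩ H, finite by induction,
    and a power of [l0], which has finite order. *)
Lemma torsion_polycyclic_finite H L : polycyclic H -> is_subgroup L ->
  L `<=` H -> L `<=` @torsion G -> finite_set L.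
Proof.
move=> pH; elim: pH L => [L LL L1 _|{}H e pH IH nHe L LL LHe LT].
  exact: sub_finite_set L1 (finite_set1 _).
have HH := polycyclic_subgroup pH.
have [l0 Ll0 HL] := subgroup_normalU1 HH nHe LL LHe.
have [L1 LM LV] := LL; have [H1 HM HV] := HH.
have /finite_seqP[s Es] : finite_set (L `&` H).
  apply: IH => [|x []//|x [/LT]//].
  by split=> [|x y [? ?] [? ?]|x [? ?]]; split;
    do ?[exact: LM|exact: HM|exact: LV|exact: HV].
have [d [d0 l0d]] := LT _ Ll0.
pose t := [seq x * l0 ^+ q | x <- s, q <- iota 0 d].
apply/(sub_finite_set _ (finite_seq (t ++ map inv t))) => l Ll /=.
have [x [q [LHx El]]] := HL l Ll.
have tx : x * l0 ^+ q \in t.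
  rewrite {1}(divn_eq q d) mulnC addnC expgnDr expgnA l0d expg1n mulg1.
  apply: allpairs_f; last by rewrite mem_iota ltn_pmod.
  by move: LHx; rewrite Es.
rewrite mem_cat; case: El => El; first by rewrite El tx.
by rewrite -[l]invgK El map_f ?orbT.
Qed.

(** * Central series and the lower central series of a finitely generated subgroup *)

Definition central_series (n : nat) (I : nat -> set G) : Prop :=
  [/\ I 0%N `<=` [set 1], I n = setT
    & forall j x g, (j < n)%N -> I j.+1 x -> I j [~ x, g]].

Lemma gen_setU1 e S : gen (e |` gen S) = gen (e |` S).
Proof.
apply/seteqP; split; apply: gen_incl => x [->|Sx].
- by apply: sub_gen_smallest; left.
- by apply: gen_incl Sx => y Sy; apply: sub_gen_smallest; right.
- by apply: sub_gen_smallest; left.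
- by apply: sub_gen_smallest; right; apply: sub_gen_smallest.
Qed.

Lemma normal_subgroup_trans M x y z : is_normal_subgroup M ->
  M (x^-1 * y) -> M (y^-1 * z) -> M (x^-1 * z).
Proof. by case=> -[_ MM _] _ /MM h /h; rewrite mulgA mulgK. Qed.

Lemma normal_subgroupX M x y m : is_normal_subgroup M ->
  M (x^-1 * y) -> M ((x ^+ m)^-1 * y ^+ m).
Proof.
move=> MN Mxy; elim: m => [|m IH]; last by rewrite !expgS; exact: is_normal_mul.
by rewrite !expg0 mulVg; case: MN => -[].
Qed.

Lemma gen_setU_normal S M x : is_normal_subgroup M -> gen (S `|` M) x ->
  exists2 p, gen S p & M (p^-1 * x).
Proof.
move=> MN; have [[M1 MM MV] MJ] := MN; have [g1 gM gV] := gen_subgroup S.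
suff gX : gen (S `|` M) `<=` [set x | exists2 p, gen S p & M (p^-1 * x)].
  by move=> /gX.
apply: gen_sub => [|y [Sy|My]].
- split=> [|y z [p Sp Mp] [q Sq Mq]|y [p Sp Mp]].
  + by exists 1; rewrite ?mulVg.
  + by exists (p * q); [exact: gM|exact: is_normal_mul].
  + by exists p^-1; [exact: gV|exact: is_normal_inv].
- by exists y; [exact: sub_gen_smallest|rewrite mulVg].
- by exists 1; rewrite ?invg1 ?mul1g.
Qed.

Section Nilpotent.
Variables (n : nat) (I : nat -> set G).
Hypothesis hI : central_series n I.

Section Generators.
Variable F : seq G.

Let K := gen [set` F].

(** The index is one less than the weight: index 0 is [F] itself. *)
Fixpoint weight_comm (k : nat) : seq G :=
  if k is k'.+1 then [seq [~ x, f] | x <- weight_comm k', f <- F] else F.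

(* Generated by the finitely many left-normed commutators of weight > k in F;
   this is the lower central series of gen F. *)
Definition lower_comm (k : nat) : set G :=
  gen [set x | exists2 i, (k <= i)%N & x \in weight_comm i].

Let K_subgroup : is_subgroup K := gen_subgroup _.

Let lower_comm_subgroup k : is_subgroup (lower_comm k) := gen_subgroup _.

Lemma weight_comm_gen k x : x \in weight_comm k -> K x.
Proof.
have [_ KM KV] := K_subgroup.
elim: k x => [x Fx|k IH _ /allpairsP[[y f] [/IH Ky Ff ->]]] /=.
  exact: sub_gen_smallest.
have Kf : K f by apply: sub_gen_smallest.
by apply: KM; [apply: KV|apply: (subgroup_normaliser K_subgroup Kf Ky).1].
Qed.

Lemma lower_comm_gen k : lower_comm k `<=` K.
Proof. by apply: gen_sub => // x [i _ /weight_comm_gen]. Qed.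

Lemma lower_comm0 : lower_comm 0 = K.
Proof.
apply/seteqP; split; first exact: lower_comm_gen.
by apply: gen_incl => x Fx; apply: sub_gen_smallest; exists 0%N.
Qed.

Lemma lower_comm_weight k i x : (k <= i)%N -> x \in weight_comm i ->
  lower_comm k x.
Proof. by move=> ki xi; apply: sub_gen_smallest; exists i. Qed.

Lemma lower_comm_le k l : (k <= l)%N -> lower_comm l `<=` lower_comm k.
Proof.
by move=> kl; apply: gen_incl => x [i li /lower_comm_weight]; apply;
  exact: leq_trans li.
Qed.

Lemma weight_comm_series k x : (k <= n)%N -> x \in weight_comm k ->
  I (n - k)%N x.
Proof.
have [I0 In Icomm] := hI.
elim: k x => [x _ _|k IH _ kn /allpairsP[[y f] [yk _ ->]]] /=.
  by rewrite subn0 In.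
apply: Icomm; first by rewrite ltn_subrL (leq_ltn_trans _ kn).
by rewrite subnSK//; apply: IH => //; exact: ltnW.
Qed.

Lemma weight_comm_eq1 k x : (n <= k)%N -> x \in weight_comm k -> x = 1.
Proof.
have [I0 In Icomm] := hI.
move=> /subnK <-; elim: (k - n)%N x => [x|d IH _ /allpairsP[[y f] [/IH -> _ ->]]] /=.
  by rewrite add0n => /(weight_comm_series (leqnn n)); rewrite subnn => /I0.
by rewrite comm1g.
Qed.

Lemma lower_comm_eq1 k : (n <= k)%N -> lower_comm k = [set 1].
Proof.
move=> nk; apply/seteqP; split => [|_ ->]; last by case: (lower_comm_subgroup k).
apply: gen_sub => [|x [i ki /weight_comm_eq1]]; last by apply; exact: leq_trans ki.
exact: polycyclic_subgroup polycyclic1.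
Qed.

(** Induction on [d] descends in k from where the terms are trivial. The case k+1 shows that K
    normalises [lower_comm k.+1], so [centraliser_mod_subgroup] reduces both arguments to
    generators, where the definition of [weight_comm] applies. *)
Lemma lower_comm_central k x g : lower_comm k x -> K g ->
  lower_comm k.+1 [~ x, g].
Proof.
have [d] : exists d, (n <= k + d)%N by exists n; rewrite leq_addl.
elim: d k x g => [|d IH] k x g; first rewrite addn0 => nk.
  rewrite (lower_comm_eq1 nk) => -> _; rewrite comm1g.
  by case: (lower_comm_subgroup k.+1).
rewrite -addSnnS => /IH {}IH Nx Kg.
set M := lower_comm k.+1.
have MS : is_subgroup M := lower_comm_subgroup k.+1.
have [M1 MM MV] := MS.
have MI : lower_comm k.+2 `<=` M by exact: lower_comm_le.
have [_ KM KV] := K_subgroup.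
have nMK : K `<=` normaliser M.
  have E y h : y ^ h = y * [~ y, h] by rewrite /commg mulVKg.
  by move=> h Kh y My; have Kh' := KV _ Kh; rewrite !E; split;
    [exact: MM My (MI _ (IH _ _ My Kh))|exact: MM My (MI _ (IH _ _ My Kh'))].
have gen_comm y : K y -> (forall f, f \in F -> M [~ y, f]) ->
    forall h, K h -> M [~ y, h].
  move=> Ky yF h Kh; rewrite -invgR; apply: (MV).
  suff [_] : [set h | K h /\ forall g, [set y] g -> M [~ h, g]] h by apply.
  move: h Kh; apply: gen_sub => [|f Ff].
    exact: (centraliser_mod_subgroup [set y] MS K_subgroup nMK).
  split=> [|_ ->]; first exact: sub_gen_smallest.
  by rewrite -invgR; apply: MV; apply: yF.
suff [_] : [set x | K x /\ forall g, K g -> M [~ x, g]] x by apply.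
move: x Nx; apply: gen_sub => [|x [i]].
  exact: (centraliser_mod_subgroup K MS K_subgroup nMK).
rewrite leq_eqVlt => /predU1P[<-{i} xk|ki xi]; split;
  do ?by [exact: weight_comm_gen xk|exact: weight_comm_gen xi].
  apply: gen_comm => [|f Ff]; first exact: weight_comm_gen xk.
  by apply: (lower_comm_weight (leqnn _)) => /=; apply: allpairs_f.
by move=> h Kh; exact: MI (IH _ _ (lower_comm_weight ki xi) Kh).
Qed.

Lemma lower_comm_normal k : K `<=` normaliser (lower_comm k).
Proof.
have [_ MM _] := lower_comm_subgroup k; have [_ _ KV] := K_subgroup.
have E y h : y ^ h = y * [~ y, h] by rewrite /commg mulVKg.
have NS := lower_comm_le (leqnSn k).
by move=> h Kh y My; have Kh' := KV _ Kh; rewrite !E; split;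
  [exact: MM My (NS _ (lower_comm_central My Kh))
  |exact: MM My (NS _ (lower_comm_central My Kh'))].
Qed.

(** The elements of [weight_comm k] are adjoined to [lower_comm k.+1] one at a time; each commutes
    with [lower_comm k] modulo [lower_comm k.+1], hence normalises what is already built. *)
Lemma lower_comm_polycyclic k : polycyclic (lower_comm k).
Proof.
have [d] : exists d, (n <= k + d)%N by exists n; rewrite leq_addl.
elim: d k => [|d IH] k; first rewrite addn0 => nk.
  by rewrite lower_comm_eq1//; exact: polycyclic1.
rewrite -addSnnS => /IH {}IH; set M := lower_comm k.+1.
have MI : M `<=` lower_comm k by exact: lower_comm_le.
suff H s : {subset s <= weight_comm k} -> polycyclic (gen ([set` s] `|` M)).
  have -> : lower_comm k = gen ([set` weight_comm k] `|` M); last exact: H.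
  apply/seteqP; split; apply: gen_incl => x.
    move=> [i]; rewrite leq_eqVlt => /predU1P[<-{i} xk|ki xi];
      apply: sub_gen_smallest; first by left.
    by right; exact: lower_comm_weight ki xi.
  by case=> [xk|/MI//]; exact: (lower_comm_weight (leqnn k) xk).
elim: s => [_|e s IHs es].
  by rewrite set_nil set0U gen_id//; exact: gen_subgroup.
have -> : gen ([set` e :: s] `|` M) = gen (e |` gen ([set` s] `|` M)).
  by rewrite gen_setU1 set_seq_cons setUA.
have ek : e \in weight_comm k by apply: es; exact: mem_head.
apply: polycyclicS; first by apply: IHs => x xs; apply: es; rewrite inE xs orbT.
have Ke := weight_comm_gen ek; have [_ _ KV] := K_subgroup.
have [_ gM _] := gen_subgroup ([set` s] `|` M).
have E y h : y ^ h = y * [~ y, h] by rewrite /commg mulVKg.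
have sN : gen ([set` s] `|` M) `<=` lower_comm k.
  apply: gen_sub => // x [xs|/MI//].
  by apply: lower_comm_weight (leqnn _) (es _ _); rewrite inE xs orbT.
by move=> h sh; rewrite !E; split; apply: gM => //; apply: sub_gen_smallest;
  right; apply: lower_comm_central; [exact: sN| |exact: sN|exact: KV].
Qed.

End Generators.

(** * Finitely generated subgroups and torsion of nilpotent groups *)

Lemma gen_polycyclic F : polycyclic (gen [set` F]).
Proof. by rewrite -lower_comm0; exact: lower_comm_polycyclic. Qed.

(** Each factor of [lower_comm F k] by [lower_comm F k.+1] is abelian, and its generators have
    finite order because the last entry of each commutator (the element itself if k = 0) does. *)
Lemma gen_torsion F : {in F, forall x, torsion x} ->
  gen [set` F] `<=` @torsion G.
Proof.
move=> FT; rewrite -lower_comm0.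
set k := 0%N; have [d] : exists d, (n <= k + d)%N by exists n.
elim: d k => [|d IH] k; first rewrite addn0 => nk.
  by rewrite lower_comm_eq1// => _ ->; exact: torsion1.
rewrite -addSnnS => /IH {}IH.
suff NX : lower_comm F k `<=` [set x | lower_comm F k x /\
    exists m, (0 < m)%N /\ lower_comm F k.+1 (x ^+ m)].
  by move=> x /NX[_ [m [m0 /IH]]]; apply: torsionX.
have KS : is_subgroup (gen [set` F]) := gen_subgroup _.
have NS i : is_subgroup (lower_comm F i) := gen_subgroup _.
have NK : lower_comm F k `<=` gen [set` F] by exact: lower_comm_gen.
have [N1 NM NV] := NS k; have [M1 MM MV] := NS k.+1.
apply: gen_sub => [|x [i]].
  split=> [|x y [Nx [a [a0 xa]]] [Ny [b [b0 yb]]]|x [Nx [a [a0 xa]]]].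
  - by split => //; exists 1%N.
  - split; first exact: NM.
    exists (a * b)%N; rewrite muln_gt0 a0; split => //.
    (* In the abelian factor, (xy)^m and x^m y^m agree. *)
    have H m : lower_comm F k.+1 ((x ^+ m * y ^+ m)^-1 * (x * y) ^+ m).
      elim: m => [|m IHm]; first by rewrite !expg0 !mulg1 invg1.
      have -> : (x ^+ m.+1 * y ^+ m.+1)^-1 * (x * y) ^+ m.+1
          = [~ y, x ^+ m] ^ (y ^+ m) * ((x ^+ m * y ^+ m)^-1 * (x * y) ^+ m).
        rewrite !expgS; move: (x ^+ m) (y ^+ m) ((x * y) ^+ m) => u v w.
        by rewrite /commg /conjg !invgM -!mulgA mulKg !mulVKg.
      apply: (MM) IHm; apply: (lower_comm_normal (NK _ (subgroupX m (NS k) Ny)) _).1.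
      exact: lower_comm_central Ny (NK _ (subgroupX m (NS k) Nx)).
    rewrite -[_ ^+ _](mulVKg (x ^+ (a * b) * y ^+ (a * b))); apply: (MM) (H _).
    apply: (MM); first by rewrite expgnA; exact: subgroupX (NS _) _.
    by rewrite mulnC expgnA; exact: subgroupX (NS _) _.
  - split; first exact: NV.
    by exists a; rewrite expVgn; split => //; apply: MV.
rewrite leq_eqVlt => /predU1P[<-{i} xk|ki xi]; last first.
  split; first by exact: lower_comm_weight (ltnW ki) xi.
  by exists 1%N; split => //; exact: lower_comm_weight ki xi.
split; first exact: lower_comm_weight (leqnn _) xk.
case: k xk {IH NS NK N1 NM NV} M1 MM MV => [|k] xk M1 MM MV.
  by have [m [m0 xm]] := FT _ xk; exists m; rewrite xm.
have /allpairsP[[u f] /= [uk Ff Ex]] := xk.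
have [m [m0 fm]] := FT _ Ff; exists m; split => //.
have Kf : gen [set` F] f by apply: sub_gen_smallest.
(* Here k has been shifted by one. As x = [u,f] is central modulo [lower_comm F k.+2], the powers
   x^i and [u,f^i] agree there; i = m makes the latter trivial. *)
have H i : lower_comm F k.+2 ((x ^+ i)^-1 * [~ u, f ^+ i]).
  elim: i => [|i IHi]; first by rewrite expg0 commg1 invg1 mulg1.
  have -> : (x ^+ i.+1)^-1 * [~ u, f ^+ i.+1]
      = ((x ^+ i)^-1 * [~ u, f ^+ i]) ^ x * [~ x, f ^+ i].
    rewrite expgSr [f ^+ i.+1]expgS; move: (x ^+ i) (f ^+ i) => y g.
    have -> : [~ u, f * g] = [~ u, g] * x ^ g.
      by rewrite Ex /commg /conjg !invgM -!mulgA !mulVKg.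
    by move: [~ u, g] => z; rewrite /commg /conjg !invgM -!mulgA !mulVKg.
  apply: (MM).
    exact: (lower_comm_normal (weight_comm_gen xk) IHi).1.
  apply: lower_comm_central (subgroupX i KS Kf).
  exact: lower_comm_weight (leqnn _) xk.
by have := MV _ (H m); rewrite fm commg1 mulg1 invgK.
Qed.

(** Closure under products is [gen_torsion] for the list of the two factors. *)
Lemma torsion_normal_subgroup : is_normal_subgroup (@torsion G).
Proof.
split; last by move=> x y; exact: torsionJ.
split=> [|x y xT yT|x]; [exact: torsion1| |exact: torsionV].
have FT : {in [:: x; y], forall z, torsion z}.
  by move=> z; rewrite !inE => /orP[] /eqP ->.
apply: (gen_torsion FT); have [_ gM _] := gen_subgroup [set` [:: x; y]].
by apply: gM; apply: sub_gen_smallest; rewrite /= !inE eqxx ?orbT.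
Qed.

End Nilpotent.

End Groups.

(** * Skew braces: [lam] as an action of the circle group on the additive group *)

Section SkewBraceTheory.
Variable A : skewBraceType.
Implicit Types (a b c d x y z : A) (M : set A).

Notation addX := (@natexp (addgroup A)).
Notation addgen := (smallest (@is_subgroup (addgroup A))).
Notation circgen := (smallest (@is_subgroup A)).

Lemma sbaddKr x y : - x + (x + y) = y.
Proof. exact: (@mulKg (addgroup A)). Qed.

Lemma sbaddNKr x y : x + (- x + y) = y.
Proof. exact: (@mulVKg (addgroup A)). Qed.

Lemma sboppD x y : - (x + y) = - y - x.
Proof. exact: (@invgM (addgroup A)). Qed.

Lemma sbopp0 : - 0 = 0 :> A.
Proof. exact: (@invg1 (addgroup A)). Qed.

Lemma sboppK x : - - x = x.
Proof. exact: (@invgK (addgroup A)). Qed.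

Lemma mul_lam a b : a * b = a + lam a b.
Proof. by rewrite /lam sbaddNKr. Qed.

Lemma lamD a b c : lam a (b + c) = lam a b + lam a c.
Proof. by rewrite /lam sbmulDr !sbaddA. Qed.

Lemma lam0 a : lam a 0 = 0.
Proof. by rewrite /lam -(sb_one0 A) mulg1 sb_one0 sbaddNr. Qed.

Lemma lamN a b : lam a (- b) = - lam a b.
Proof.
by rewrite -[LHS](sbaddKr (lam a b)) -lamD sbaddrN lam0 sbaddr0.
Qed.

Lemma lamM a b c : lam (a * b) c = lam a (lam b c).
Proof.
by rewrite [lam b c]/lam lamD lamN /lam sboppD sboppK -!sbaddA sbaddNKr mulgA.
Qed.

Lemma lam1 b : lam 1 b = b.
Proof. by rewrite /lam mul1g sb_one0 sbopp0 sbadd0r. Qed.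

(** Makes [lam]-invariant additive subgroups closed under circle inverses. *)
Lemma invg_lam a : a^-1 = - lam a^-1 a.
Proof. by rewrite /lam mulVg sb_one0 sbaddr0 sboppK. Qed.

Lemma addXS x m : addX x m.+1 = x + addX x m.
Proof. exact: (@expgS (addgroup A)). Qed.

Lemma lamX a b m : lam a (addX b m) = addX (lam a b) m.
Proof.
elim: m => [|m IH]; first exact: lam0.
by rewrite !addXS lamD IH.
Qed.

(** Known as a strong left ideal; addition and every [lam a] descend to its cosets. *)
Definition left_ideal M :=
  @is_normal_subgroup (addgroup A) M /\ forall a b, M b -> M (lam a b).

Lemma ideal_left_ideal (I : ideal A) : left_ideal I.
Proof. by have [] := idealP I. Qed.

(** Modulo M, [lam x] fixes x and hence its multiples, so x^(m+1) = x + lam x (x^m) is congruent to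
    x + m x. *)
Lemma left_ideal_expg M x m : left_ideal M -> M (- x + lam x x) ->
  M (- addX x m + x ^+ m).
Proof.
move=> [MN Mlam] Mx; elim: m => [|m IH].
  by rewrite [x ^+ 0]sb_one0 sbaddNr; case: MN => -[].
rewrite (@expgS A) mul_lam addXS.
apply: (@is_normal_mul (addgroup A)) => //.
  by rewrite (@mulVg (addgroup A)); case: MN => -[].
apply: (@normal_subgroup_trans (addgroup A) _ _ (lam x (addX x m))) => //.
  by rewrite lamX; exact: (@normal_subgroupX (addgroup A)).
by have := Mlam x _ IH; rewrite lamD lamN.
Qed.

(** * Additive and circle torsion along an annihilator series *)

Section AnnihilatorSeries.
Variables (n : nat) (I : nat -> ideal A).
Hypothesis hI : annihilator_series n I.

Lemma annihilator_seriesP j x a : (j < n)%N -> ideal_set (I j.+1) x ->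
  [/\ ideal_set (I j) (- (x * a) + (x + a)), ideal_set (I j) (- a + lam x a),
      ideal_set (I j) (- x + lam a x)
    & ideal_set (I j) (- (a + x) + (x + a))].
Proof.
case: hI => _ _ /[apply] -[_ IAnn] Ix.
have /(_ (\pi_(quot (I j)) a)) := IAnn _ (imageP _ Ix).
rewrite -!pi_quotM -!pi_quotD => -[E1 E2 E3].
split; first by apply/pi_quotP; rewrite E1 E2.
- by rewrite /lam sbaddA -sboppD; apply/pi_quotP; rewrite E1 E2.
- by rewrite /lam sbaddA -sboppD; apply/pi_quotP; rewrite E2 E3.
- by apply/pi_quotP; rewrite E3.
Qed.

Lemma annihilator_series_central :
  @central_series (addgroup A) n (fun j => ideal_set (I j)).
Proof.
have [I0 In _] := hI; split; [by rewrite I0|by []|] => j x g jn Ix.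
have [_ _ _] := annihilator_seriesP g jn Ix.
by rewrite [_ + _](_ : _ = [~ (x : addgroup A), g])// /commg /conjg mulgA -invgM.
Qed.

Lemma Tadd_left_ideal : left_ideal (Tadd A).
Proof.
split; first exact: torsion_normal_subgroup annihilator_series_central.
by move=> a b [m [m0 bm]]; exists m; rewrite -lamX bm lam0.
Qed.

Lemma Tadd_mul x y : Tadd A x -> Tadd A y -> Tadd A (x * y).
Proof.
have [[[_ TM _] _] Tlam] := Tadd_left_ideal.
by move=> Tx Ty; rewrite mul_lam; apply: TM => //; exact: Tlam.
Qed.

(** For x in I_(j+1), [lam x] fixes x modulo I_j, so m x = 0 puts x^m in I_j; this power stays in
    [Tadd A], and the descent ends at I_0 = 0. *)
Lemma Tadd_sub_Tcirc : Tadd A `<=` Tcirc A.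
Proof.
have [I0 In _] := hI.
suff H j x : (j <= n)%N -> ideal_set (I j) x -> Tadd A x -> Tcirc A x.
  by move=> x; apply: (H n) => //; rewrite In.
elim: j x => [|j IH] x jn Ix Tx.
  by move: Ix; rewrite I0 => ->; rewrite -sb_one0; exact: torsion1.
have [m [m0 xm]] := Tx; apply: (torsionX m0); apply: IH; first exact: ltnW.
  have [_ Ixx _ _] := annihilator_seriesP x jn Ix.
  by have := left_ideal_expg m (ideal_left_ideal (I j)) Ixx;
    rewrite xm [- _]sbopp0 sbadd0r.
have T1 : Tadd A 1 by rewrite sb_one0; exact: torsion1.
by elim: (m) => // k IHk; rewrite expgS; exact: Tadd_mul.
Qed.

(** For c in I_(k+1), d = -c + lam x c lies in I_k, so by induction [lam x] fixes d modulo T. Then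
    lam (x^i) c is congruent to c + i d, and x^m = 1 puts m d, hence d, in T. *)
Lemma Tcirc_lam x c : Tcirc A x -> Tadd A (- c + lam x c).
Proof.
have [I0 In _] := hI; have [TN Tlam] := Tadd_left_ideal.
have [[T1 TM TV] _] := TN => -[m [m0 xm]].
suff H k : (k <= n)%N -> ideal_set (I k) `<=` [set c | Tadd A (- c + lam x c)].
  by apply: (H n) => //; rewrite In.
elim: k => [_|k IH kn] {}c; first by rewrite I0 => -> /=; rewrite lam0 sbaddNr.
move=> Ic /=; set d := - c + lam x c.
have Td : Tadd A (- d + lam x d).
  by apply: IH (ltnW kn) _ _; have [] := annihilator_seriesP x kn Ic.
have H i : Tadd A (- (c + addX d i) + lam (x ^+ i) c).
  elim: i => [|i IHi]; first by rewrite lam1 sbaddr0 sbaddNr.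
  rewrite (@expgS A) lamM.
  apply: (@normal_subgroup_trans (addgroup A) _ _ (lam x (c + addX d i))) => //.
    rewrite lamD lamX addXS sbaddA.
    apply: (@is_normal_mul (addgroup A)) => //.
      by rewrite sbaddNKr (@mulVg (addgroup A)).
    exact: (@normal_subgroupX (addgroup A)).
  by have := Tlam x _ IHi; rewrite [in X in X -> _]lamD lamN.
apply: (torsionX m0).
suff -> : addX d m = - (- (c + addX d m) + lam (x ^+ m) c) by apply: TV.
by rewrite xm lam1 sboppD sboppK sbaddKr.
Qed.

Lemma Tcirc_sub_Tadd : Tcirc A `<=` Tadd A.
Proof.
move=> x Tx; have [m [m0 xm]] := Tx; apply: (torsionX m0).
have [[[_ _ TV] _] _] := Tadd_left_ideal.
have := left_ideal_expg m Tadd_left_ideal (Tcirc_lam x Tx).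
by rewrite xm sb_one0 sbaddr0 => /TV; rewrite [_^-1]invgK.
Qed.

Lemma Tadd_Tcirc : Tadd A = Tcirc A.
Proof. by apply/seteqP; split; [exact: Tadd_sub_Tcirc|exact: Tcirc_sub_Tadd]. Qed.

Lemma Tadd_ideal : is_ideal (Tadd A).
Proof.
have [TN Tlam] := Tadd_left_ideal; split => //; split; last first.
  by rewrite Tadd_Tcirc => x y; exact: torsionJ.
split; [|exact: Tadd_mul|by rewrite Tadd_Tcirc => x; exact: torsionV].
by rewrite sb_one0; exact: torsion1.
Qed.

(** * Finite generation along an annihilator series *)

Lemma circ_subgroup_cong (I0 : ideal A) (C : set A) x y :
  @is_subgroup A C -> ideal_set I0 `<=` C -> ideal_set I0 (- x + y) ->
  C x -> C y.
Proof.
move=> [_ CM _] IC /eq_mod_ideal_circ/IC Cxy Cx.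
by rewrite -[y](mulVKg x); apply: CM.
Qed.

(** One list serves both groups: in the descent, additive generation approximates lam g f by sums,
    circle generation reduces [lam]-invariance to generators, and X ⊆ F lets the hypothesis on sub
    skew braces apply. *)
Definition fg_mod (X : seq A) (M : set A) : Prop :=
  exists F : seq A, [/\ {subset X <= F}, addgen ([set` F] `|` M) = setT
    & circgen ([set` F] `|` M) = setT].

Lemma fg_mod_annihilator_series (X : seq A) :
    (forall B, is_sub_skew_brace B -> [set` X] `<=` B -> B = setT) ->
  forall j, (j < n)%N -> fg_mod X (I j.+1) -> fg_mod X (I j).
Proof.
move=> hX j jn [F [XF addF circF]].
set Z := ideal_set (I j.+1) in addF circF; set M := ideal_set (I j).
have [ZN Zcirc Zlam] := idealP (I j.+1); have [MN Mcirc Mlam] := idealP (I j).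
have [[Z1 ZM ZV] ZJ] := ZN; have [[M1 MM MV] MJ] := MN.
have MZ : M `<=` Z by case: hI => _ _ /(_ j jn)[].
have ann x a : Z x -> [/\ M (- (x * a) + (x + a)), M (- a + lam x a)
    & M (- x + lam a x)].
  by move=> Zx; have [] := annihilator_seriesP a jn Zx.
have /choice[p pP] a : exists p, addgen [set` F] p /\ Z (- p + a).
  have : addgen ([set` F] `|` Z) a by rewrite addF.
  by move=> /(gen_setU_normal ZN)[p Fp Zpa]; exists p.
(* The errors, in Z, of approximating lam g f by elements of the additive span of F. Inverses enter
   because the stabiliser of B must be closed under them. *)
pose D := [seq - p (lam g f) + lam g f | g <- F ++ map inv F, f <- F].
have DZ d : d \in D -> Z d.
  by move=> /allpairsP[[g f] [_ _ ->]]; have [] := pP (lam g f).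
pose B := addgen ([set` F ++ D] `|` M).
have BS : @is_subgroup (addgroup A) B by exact: gen_subgroup.
have [B1 BM BV] := BS.
have MB : M `<=` B by move=> x Mx; apply: sub_gen_smallest; right.
have FB f : f \in F -> B f.
  by move=> Ff; apply: sub_gen_smallest; left; rewrite /= mem_cat Ff.
have genFB : addgen [set` F] `<=` B by apply: gen_sub.
have DB d : d \in D -> B d.
  by move=> Dd; apply: sub_gen_smallest; left; rewrite /= mem_cat Dd orbT.
have lamFB g : g \in F ++ map inv F -> B `<=` [set b | B (lam g b)].
  move=> Fg; apply: gen_sub => [|b [|Mb]].
  - split=> [|x y Bx By|x Bx] /=.
    + by rewrite lam0.
    + by rewrite lamD; apply: BM.
    + by rewrite lamN; apply: BV.
  - rewrite /= mem_cat => /orP[Fb|Db].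
      rewrite -[lam g b](sbaddNKr (p (lam g b))); apply: (BM).
        by apply: genFB; have [] := pP (lam g b).
      by apply: DB; apply: allpairs_f.
    rewrite -[lam g b](sbaddNKr b); apply: (BM); first exact: DB.
    by apply: MB; have [] := ann b g (DZ _ Db).
  - exact: MB (Mlam _ _ Mb).
(* The a for which [lam a] and [lam a^-1] preserve B form a circle subgroup; it contains F by the
   choice of D, and Z because Z acts trivially modulo M. *)
have lamB a : B `<=` [set b | B (lam a b)].
  suff [] : [set a | (B `<=` [set b | B (lam a b)]) /\
                     (B `<=` [set b | B (lam a^-1 b)])] a by [].
  have : circgen ([set` F] `|` Z) a by rewrite circF.
  move: a; apply: gen_sub => [|x [Fx|Zx]].
  - split=> [|x y [Bx BVx] [By BVy]|x [Bx BVx]] /=; last by rewrite invgK.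
      by rewrite invg1; split=> b /=; rewrite lam1.
    split=> b Bb; rewrite /= ?invgM lamM; first exact: Bx (By _ Bb).
    exact: BVy (BVx _ Bb).
  - split; apply: lamFB; rewrite mem_cat; first by rewrite [x \in F]Fx.
    by rewrite [_^-1 \in map _ _]map_f ?orbT.
  - have lamZ z : Z z -> B `<=` [set b | B (lam z b)].
      move=> Zz b Bb /=; rewrite -[lam z b](sbaddNKr b); apply: (BM) => //.
      by apply: MB; have [] := ann z b Zz.
    by split; apply: lamZ => //; have [[_ _ /(_ _ Zx)]] := Zcirc.
have BT : B = setT.
  apply: hX => [|x /XF]; last exact: FB.
  split=> //; split; first by rewrite sb_one0.
    by move=> x y Bx By; rewrite mul_lam; apply: (BM) => //; exact: lamB.
  by move=> x Bx; rewrite invg_lam; apply: (BV); exact: lamB.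
(* The additive span of F ++ D is polycyclic, so its intersection with Z has finitely many
   generators D'; since B = A, they generate Z modulo M. *)
have genS := gen_subgroup ([set` F ++ D] : set (addgroup A)).
have [|x []//|D' ED'] := @subgroup_polycyclic_fg (addgroup A) _
    (Z `&` addgen [set` F ++ D])
    (gen_polycyclic annihilator_series_central (F ++ D)).
  have [g1 gM gV] := genS.
  split=> [|x y [? ?] [? ?]|x [? ?]]; first by split.
    by split; [apply: ZM|apply: gM].
  by split; [apply: ZV|apply: gV].
exists (F ++ D ++ D'); split=> [x /XF Fx||].
- by rewrite mem_cat Fx.
- apply/seteqP; split => // x _; have : B x by rewrite BT.
  apply: gen_incl => y [|My]; last by apply: sub_gen_smallest; right.
  by move=> /= FDy; apply: sub_gen_smallest; left; rewrite /= catA mem_cat FDy.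
pose C := circgen ([set` F ++ D ++ D'] `|` M).
have CS : @is_subgroup A C by exact: gen_subgroup.
have [C1 CM CV] := CS.
have MC : M `<=` C by move=> x Mx; apply: sub_gen_smallest; right.
have Ccong x y : M (- x + y) -> C x -> C y by exact: circ_subgroup_cong.
(* On Z, sum and circle product agree modulo M, and M lies in C; hence Z ∩ C is an additive
   subgroup. *)
have D'C : addgen [set` D'] `<=` Z `&` C.
  apply: gen_sub => [|d D'd].
  - split=> [|x y [Zx Cx] [Zy Cy]|x [Zx Cx]].
    + by split => //; move: C1; rewrite sb_one0.
    + split; first exact: ZM.
      by have [Mxy _ _] := ann x y Zx; apply: Ccong Mxy _; apply: CM.
    + split; first exact: ZV.
      have [+ _ _] := ann x (- x) Zx; rewrite sbaddrN sbaddr0 => Mx.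
      have /MC Cxx : M ((x : A) * - x).
        by have := MV _ Mx; rewrite [_^-1]sboppK.
      suff : C ((x : A)^-1 * ((x : A) * - x)) by rewrite mulKg.
      by apply: CM => //; apply: CV.
  - split; last by apply: sub_gen_smallest; left; rewrite /= !mem_cat D'd !orbT.
    suff [] : (Z `&` addgen [set` F ++ D]) d by [].
    by rewrite ED'; exact: sub_gen_smallest.
have ZC : Z `<=` C.
  move=> z Zz; have : B z by rewrite BT.
  move=> /(gen_setU_normal MN)[q FDq Mqz]; apply: (Ccong _ _ Mqz).
  have Zq : Z q.
    have -> : q = z - (- q + z) by rewrite sboppD sboppK sbaddA sbaddrN sbadd0r.
    exact: ZM Zz (ZV _ (MZ _ Mqz)).
  suff /D'C[] : addgen [set` D'] q by [].
  by rewrite -ED'.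
apply/seteqP; split => // x _; rewrite -/C.
have : circgen ([set` F] `|` Z) x by rewrite circF.
move: x; apply: gen_sub => // x [Fx|/ZC//].
by apply: sub_gen_smallest; left; rewrite /= mem_cat Fx.
Qed.

Lemma finitely_generated_add : finitely_generated A ->
  exists F : seq A, addgen [set` F] = setT.
Proof.
move=> [_ [/finite_seqP[X ->] hX]].
have [I0 In _] := hI.
(* The descent starts at I_n = A, where X itself serves. *)
have H k : (k <= n)%N -> fg_mod X (I (n - k)%N).
  elim: k => [_|k IH kn].
    exists X; rewrite subn0 In; split => //; rewrite setUT; apply: gen_id;
      by split.
  apply: fg_mod_annihilator_series => //.
    by rewrite ltn_subrL (leq_ltn_trans _ kn).
  by rewrite subnSK//; apply: IH; exact: ltnW.
have [F [_ FT _]] := H n (leqnn n); exists F.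
apply/seteqP; split => // x _; have : addgen ([set` F] `|` I 0%N) x.
  by move: FT; rewrite subnn => ->.
apply: gen_incl => y [Fy|]; first exact: sub_gen_smallest.
by rewrite I0 => ->; case: (gen_subgroup ([set` F] : set (addgroup A))).
Qed.

Lemma finite_Tadd : finitely_generated A -> finite_set (Tadd A).
Proof.
move=> /finitely_generated_add[F FT].
have [[TS _] _] := Tadd_left_ideal.
apply: (torsion_polycyclic_finite (gen_polycyclic annihilator_series_central F)
  TS) => //.
by rewrite FT.
Qed.

End AnnihilatorSeries.

(** * The quotient by the torsion, and the theorem *)

Lemma Tadd_quot (hT : is_ideal (Tadd A)) :
  Tadd (quot (Ideal hT)) = [set 0].
Proof.
have piX x m : @natexp (addgroup (quot (Ideal hT))) (\pi_(quot (Ideal hT)) x) m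
    = \pi_(quot (Ideal hT)) (addX x m).
  elim: m => [//|m IH].
  by rewrite addXS pi_quotD -IH (@expgS (addgroup _)).
apply/seteqP; split=> [X|_ ->]; last exact: (@torsion1 (addgroup _)).
(* If the class of m x is zero, then m x has finite order, and so does x. *)
elim/quot_ind: X => x [m [m0]]; rewrite piX => /esym/pi_quotP /=.
rewrite sbopp0 sbadd0r => /(torsionX m0) Tx.
by apply/esym/pi_quotP; rewrite sbopp0 sbadd0r.
Qed.

End SkewBraceTheory.

Theorem proposition4p2 (A : skewBraceType) (hA : annihilator_nilpotent A) :
  [/\ Tadd A = Tcirc A,
      is_ideal (Tadd A),
      forall hT : is_ideal (Tadd A), Tadd (quot (Ideal hT)) = [set 0]
    & finitely_generated A -> finite_set (Tadd A)].
Proof.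
have [n [I hI]] := hA; split.
- exact: Tadd_Tcirc hI.
- exact: Tadd_ideal hI.
- exact: Tadd_quot.
- exact: finite_Tadd hI.
Qed.
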